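(* Let $X$ be a random variable with discrete representation having support tensor $\mathcal{S}\in\mathbb{R}^{n_1\times\cdots\times n_d}$ and probability mass tensor $\mathcal{M}\in\mathbb{R}^{n_1\times\cdots\times n_d}$, both in tensor train format, and let $k\ge1$ be an integer. Then the $k$-th moment $\mu_k^{\mathrm{disc}}$ of the discrete representation of $X$ is given by $$\mu_k^{\mathrm{disc}}=\frac{\langle\mathcal{S}^{\odot k},\mathcal{M}\rangle}{\langle\mathbf{1},\mathcal{M}\rangle},$$ and, with $n=\max_j n_j$ and $r$ an upper bound on the TT-ranks of the given tensor train representations of $\mathcal{S}^{\odot k}$ and $\mathcal{M}$, this quantity can be computed from the tensor train cores in $\mathcal{O}(dnr^3)$ arithmetic operations.
   Context: A discrete representation of $X$ by a support tensor $\mathcal{S}$ and a probability mass tensor $\mathcal{M}$ (with nonnegative entries summing to $1$) means the Dirac mixture $\sum_{i_1,\dots,i_d}\mathcal{M}_{i_1,\dots,i_d}\,\delta(x-\mathcal{S}_{i_1,\dots,i_d})$; its $k$-th moment $\mu_k^{\mathrm{disc}}$ is the $k$-th raw moment of this discrete distribution. A tensor $\mathcal{T}\in\mathbb{R}^{n_1\times\cdots\times n_d}$ is in tensor train (TT) format if it is given by cores $\mathcal{G}^{(j)}\in\mathbb{R}^{r_{j-1}\times n_j\times r_j}$, $r_0=r_d=1$, with slices $\mathbf{G}^{(j)}_{i_j}\in\mathbb{R}^{r_{j-1}\times r_j}$ such that $\mathcal{T}_{i_1,\dots,i_d}=\mathbf{G}^{(1)}_{i_1}\cdots\mathbf{G}^{(d)}_{i_d}$;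 the $r_j$ are its TT-ranks. $\mathcal{S}^{\odot k}$ is the $k$-th Hadamard (entrywise) power; $\mathbf{1}$ is the all-ones tensor; $\langle\mathcal{A},\mathcal{B}\rangle=\sum_{i_1,\dots,i_d}\mathcal{A}_{i_1,\dots,i_d}\mathcal{B}_{i_1,\dots,i_d}$ is the inner product, evaluated by contraction of TT cores. *)

(* Defs.v *)
From HB Require Import structures.
From mathcomp Require Import all_boot all_order all_algebra.
From mathcomp Require Import all_classical all_reals all_analysis.
Set Implicit Arguments.
Unset Strict Implicit.
Unset Printing Implicit Defensive.
Import Order.TTheory GRing.Theory Num.Theory.
Local Open Scope ring_scope.

(** * Tensors *)

Definition multi_index (d : nat) (n : 'I_d -> nat) : finType :=
  {dffun forall j : 'I_d, 'I_(n j)}.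

Definition tensor (R : Type) (d : nat) (n : 'I_d -> nat) : Type :=
  {ffun multi_index n -> R}.

Definition ones_tensor (R : pzRingType) (d : nat) (n : 'I_d -> nat) :
  tensor R n := [ffun=> 1].

Definition hadamard_pow (R : pzRingType) (d : nat) (n : 'I_d -> nat)
  (T : tensor R n) (k : nat) : tensor R n := [ffun i => T i ^+ k].

Definition tensor_inner (R : pzRingType) (d : nat) (n : 'I_d -> nat)
  (A B : tensor R n) : R := \sum_(i : multi_index n) A i * B i.

(** * Tensor trains *)

(* Only the ranks [r_0, ..., r_d] are meaningful: the values of [tt_rank] above
   [d] are never used. *)
Record tt_ranks (d : nat) : Type := TTRanks {
  tt_rank :> nat -> nat;
  tt_rank_first : tt_rank 0 = 1%N;
  tt_rank_last : tt_rank d = 1%N }.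

(* [G j i] is the slice of the core of position [j] (counted from 0) at the
   mode index [i]. *)
Definition tt_cores (R : Type) (d : nat) (n : 'I_d -> nat) (r : tt_ranks d) :
  Type := forall j : 'I_d, 'I_(n j) -> 'M[R]_(r j, r j.+1).

(* The product of the first [m] slices selected by the multi-index [i]. *)
Fixpoint tt_prefix (R : pzRingType) (d : nat) (n : 'I_d -> nat)
    (r : tt_ranks d) (G : tt_cores R n r) (i : multi_index n) (m : nat) :
    (m <= d)%N -> 'M[R]_(r 0, r m) :=
  match m return (m <= d)%N -> 'M[R]_(r 0, r m) with
  | 0 => fun=> 1%:M
  | m'.+1 => fun lt_m'd =>
      tt_prefix G i (ltnW lt_m'd)
        *m G (Ordinal lt_m'd) (i (Ordinal lt_m'd))
  end.

Definition tt_entry (R : pzRingType) (d : nat) (n : 'I_d -> nat)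
    (r : tt_ranks d) (G : tt_cores R n r) (i : multi_index n) : R :=
  castmx (tt_rank_first r, tt_rank_last r) (tt_prefix G i (leqnn d)) ord0 ord0.

Definition tt_format (R : pzRingType) (d : nat) (n : 'I_d -> nat)
    (r : tt_ranks d) (G : tt_cores R n r) (T : tensor R n) : Prop :=
  forall i : multi_index n, T i = tt_entry G i.

Definition tt_ranks_bounded (d : nat) (r : tt_ranks d) (b : nat) : Prop :=
  forall j : nat, (j <= d)%N -> (r j <= b)%N.

(** * Discrete representations *)

Record mass_tensor (R : realType) (d : nat) (n : 'I_d -> nat) : Type :=
  MassTensor {
    mass :> tensor R n;
    mass_ge0 : forall i : multi_index n, 0 <= mass i;
    mass_sum1 : \sum_(i : multi_index n) mass i = 1 }.

Section DiracMixture.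
Context (R : realType) (d : nat) (n : 'I_d -> nat).
Variables (S : tensor R n) (M : mass_tensor R n).
Local Open Scope ereal_scope.

Definition dirac_mixture (A : set (measurableTypeR R)) : \bar R :=
  \sum_(i : multi_index n) (mass M i)%:E * \d_(S i) A.

Let dirac_mixture0 : dirac_mixture set0 = 0.
Proof. by rewrite /dirac_mixture big1// => i _; rewrite measure0 mule0. Qed.

Let dirac_mixture_ge0 A : 0 <= dirac_mixture A.
Proof.
by apply: sume_ge0 => i _; rewrite mule_ge0// lee_fin mass_ge0.
Qed.

Let dirac_mixture_sigma_additive : semi_sigma_additive dirac_mixture.
Proof.
move=> F mF tF mUF.
under eq_fun do rewrite exchange_big.
apply: cvg_nnesum => /= [i _|i _].
  by apply: nearW => N; apply: sume_ge0 => k _; rewrite mule_ge0// lee_fin mass_ge0.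
exact: (@measure_semi_sigma_additive _ _ _
  (mscale (NngNum (mass_ge0 M i)) \d_(S i)) F mF tF mUF).
Qed.

HB.instance Definition _ := isMeasure.Build _ _ _ dirac_mixture
  dirac_mixture0 dirac_mixture_ge0 dirac_mixture_sigma_additive.

Let dirac_mixture_setT : dirac_mixture [set: _] = 1.
Proof.
rewrite /dirac_mixture.
under eq_bigr do rewrite diracT mule1.
by rewrite sumEFin mass_sum1.
Qed.

HB.instance Definition _ := Measure_isProbability.Build _ _ _ dirac_mixture
  dirac_mixture_setT.

End DiracMixture.

Definition disc_moment (R : realType) (d : nat) (n : 'I_d -> nat)
    (S : tensor R n) (M : mass_tensor R n) (k : nat) : \bar R :=
  'E_(dirac_mixture S M)[fun x : measurableTypeR R => x ^+ k].

(** * Arithmetic straight-line programs *)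

(* [Result t] is the result of the [t]-th instruction, counted from 0. *)
Inductive operand (I : Type) : Type :=
  | Input of I
  | Zero
  | One
  | Result of nat.
Arguments Zero {I}.
Arguments One {I}.
Arguments Result {I} _.

Inductive arith_op : Type := Add | Sub | Mul | Div.

Record instruction (I : Type) : Type := Instruction {
  instr_op : arith_op;
  instr_lhs : operand I;
  instr_rhs : operand I }.

Record slp (I : Type) : Type := SLP {
  slp_code : seq (instruction I);
  slp_output : operand I }.

Definition operation_count (I : Type) (P : slp I) : nat := size (slp_code P).

Section Execution.
Context (F : fieldType) (I : Type).
Variable input : I -> F.

Definition fetch (results : seq F) (o : operand I) : option F :=
  match o with
  | Input v => Some (input v)
  | Zero => Some 0
  | One => Some 1
  | Result t => onth results t
  end.

(* A division by zero makes the whole run fail. *)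
Definition apply_op (o : arith_op) (x y : F) : option F :=
  match o with
  | Add => Some (x + y)
  | Sub => Some (x - y)
  | Mul => Some (x * y)
  | Div => if y == 0 then None else Some (x / y)
  end.

Definition exec_instruction (results : seq F) (c : instruction I) :
    option (seq F) :=
  if fetch results (instr_lhs c) is Some x then
    if fetch results (instr_rhs c) is Some y then
      omap (rcons results) (apply_op (instr_op c) x y)
    else None
  else None.

Fixpoint exec_code (results : seq F) (cs : seq (instruction I)) :
    option (seq F) :=
  if cs is c :: cs' then
    obind (exec_code^~ cs') (exec_instruction results c)
  else Some results.

Definition run_slp (P : slp I) : option F :=
  obind (fetch^~ (slp_output P)) (exec_code [::] (slp_code P)).

End Execution.

(* The positions of the scalar entries of the cores of a tensor train. *)
Definition core_position (d : nat) (n : 'I_d -> nat) (r : tt_ranks d) : Type :=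
  {j : 'I_d & ('I_(r j) * 'I_(n j) * 'I_(r j.+1))%type}.

Definition core_value (R : Type) (d : nat) (n : 'I_d -> nat) (r : tt_ranks d)
    (G : tt_cores R n r) (v : core_position n r) : R :=
  let: existT j (a, i, b) := v in G j i a b.

Definition core_inputs (R : Type) (d : nat) (n : 'I_d -> nat)
    (rA rB : tt_ranks d) (A : tt_cores R n rA) (B : tt_cores R n rB)
    (v : core_position n rA + core_position n rB) : R :=
  match v with
  | inl u => core_value A u
  | inr u => core_value B u
  end.

(* Main.v *)
Require Import Defs.
From mathcomp Require Import all_boot all_order all_algebra.
From mathcomp Require Import all_classical all_reals all_analysis.
From mathcomp Require Import measurable_realfun.
Set Implicit Arguments.
Unset Strict Implicit.
Unset Printing Implicit Defensive.
Import Order.TTheory GRing.Theory Num.Theory.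
Local Open Scope ring_scope.

(** Integrating [x ^ k] against the Dirac mixture gives [<S^k, M>], and
    [<1, M> = 1] because the masses sum to [1]; a program for the quotient may
    therefore omit the denominator and the division.  For cores [A] of [S^k]
    and [B] of [M], distributivity lets the sum over multi-indices be done one
    mode at a time: with [V] the all-ones matrix at first and
    [V := \sum_x (A_x)^T V B_x] at each mode, the last [V] is the 1 x 1 matrix
    [<S^k, M>].  A mode of size at most [N] costs two [r x r] matrix products
    per slice, that is [4 N r^3] operations. *)

(** * Integration against the Dirac mixture *)

Lemma ge0_integral_dirac_mixture (R : realType) (d : nat) (n : 'I_d -> nat)
    (S : tensor R n) (M : mass_tensor R n) (f : measurableTypeR R -> \bar R) :
  (forall x, 0 <= f x)%E -> measurable_fun setT f ->
  (\int[dirac_mixture S M]_x f x =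
     \sum_(i : multi_index n) (mass M i)%:E * f (S i))%E.
Proof.
move=> f_ge0 mf.
pose idx (i0 : multi_index n) (l : nat) := nth i0 (enum (multi_index n)) l.
(* [nth] needs a default multi-index; one exists, since masses over an empty index set would sum to
   0 instead of 1. *)
have [i0 _|empty] := pickP (multi_index n); last first.
  have := mass_sum1 M; rewrite big_pred0; last by move=> i; exact: empty.
  by move=> /esym/eqP; rewrite oner_eq0.
(* Enumerating the multi-indices turns the mixture into an [msum] of scaled Diracs, and the integral
   is additive in such a measure. *)
pose m (l : nat) : {measure set (measurableTypeR R) -> \bar R} :=
  mscale (NngNum (mass_ge0 M (idx i0 l))) (@dirac _ (measurableTypeR R) (S (idx i0 l)) R).
have reindex_msum (g : multi_index n -> \bar R) :
    (\sum_(i : multi_index n) g i =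
       \sum_(l < size (enum (multi_index n))) g (idx i0 l))%E.
  by rewrite -[LHS]big_enum (big_nth i0) big_mkord.
rewrite (eq_measure_integral (msum m (size (enum (multi_index n))))); last first.
  by move=> A mA _; rewrite [LHS]reindex_msum.
rewrite ge0_integral_measure_sum// reindex_msum; apply: eq_bigr => l _.
by rewrite ge0_integral_mscale// integral_dirac// diracT mul1e.
Qed.

(** The positive and negative parts of [f] both integrate to finite sums, so their extended-real
    difference is a real one and recombines termwise. *)
Lemma integral_dirac_mixture (R : realType) (d : nat) (n : 'I_d -> nat)
    (S : tensor R n) (M : mass_tensor R n) (f : measurableTypeR R -> R) :
  measurable_fun setT f ->
  (\int[dirac_mixture S M]_x (f x)%:E)%E =
    (\sum_(i : multi_index n) mass M i * f (S i))%:E.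
Proof.
move=> mf; have mEf := (measurable_EFinP _ _).2 mf.
rewrite integralE !ge0_integral_dirac_mixture//; last 2 first.
  exact: measurable_funeneg.
  exact: measurable_funepos.
rewrite funerpos funerneg.
under eq_bigr do rewrite /= -EFinM.
under [X in (_ - X)%E]eq_bigr do rewrite /= -EFinM.
rewrite !sumEFin -EFinB -sumrB; congr EFin; apply: eq_bigr => i _.
by rewrite -mulrBr -[in RHS](funrposBneg f).
Qed.

Lemma disc_moment_sum (R : realType) (d : nat) (n : 'I_d -> nat)
    (S : tensor R n) (M : mass_tensor R n) (k : nat) :
  disc_moment S M k = (tensor_inner (hadamard_pow S k) M)%:E.
Proof.
rewrite /disc_moment unlock integral_dirac_mixture; last exact: exprn_measurable.
by congr EFin; apply: eq_bigr => i _; rewrite ffunE mulrC.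
Qed.

Lemma tensor_inner_ones_mass (R : realType) (d : nat) (n : 'I_d -> nat)
    (M : mass_tensor R n) : tensor_inner (ones_tensor R n) M = 1.
Proof.
by rewrite -(mass_sum1 M); apply: eq_bigr => i _; rewrite ffunE mul1r.
Qed.

(** * Building straight-line programs with operation counts *)

Section Programs.
Context (F : fieldType) (I E : Type) (input : E -> I -> F).
Implicit Types (cs : seq (instruction I)) (o : operand I) (f : E -> F).

(* The same code has to be correct for every environment [e : E].  In particular
   [computes cs Zero (fun=> 0)] says that [cs] never fails. *)
Definition computes cs o f : Prop :=
  forall e, run_slp (input e) (SLP cs o) = Some (f e).

(* [cs'] need not literally continue [cs]: it only has to make the same operands
   available. *)
Definition extends (c : nat) cs cs' : Prop :=
  (forall o f, computes cs o f -> computes cs' o f) /\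
  (size cs' <= size cs + c)%N.

Lemma extends_refl cs : extends 0 cs cs.
Proof. by split=> //; rewrite addn0. Qed.

Lemma extends_trans c c' cs1 cs2 cs3 :
  extends c cs1 cs2 -> extends c' cs2 cs3 -> extends (c + c') cs1 cs3.
Proof.
move=> [pres12 size2] [pres23 size3]; split=> [u f /pres12/pres23//|].
by rewrite (leq_trans size3)// addnA leq_add2r.
Qed.

Lemma extends_leq c c' cs cs' :
  (c <= c')%N -> extends c cs cs' -> extends c' cs cs'.
Proof.
by move=> cc' [pres size'];split=> //; rewrite (leq_trans size')// leq_add2l.
Qed.

Lemma exec_code_rcons (inp : I -> F) (res : seq F) cs (c : instruction I) :
  exec_code inp res (rcons cs c) =
  obind (exec_instruction inp ^~ c) (exec_code inp res cs).
Proof.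
elim: cs res => [|c' cs IHcs] res /=; first by case: exec_instruction.
by case: (exec_instruction inp res c') => //= res'; exact: IHcs.
Qed.

Lemma size_exec_code (inp : I -> F) (res res' : seq F) cs :
  exec_code inp res cs = Some res' -> size res' = (size res + size cs)%N.
Proof.
elim: cs res => [|c cs IHcs] res /=; first by case=> ->; rewrite addn0.
rewrite /exec_instruction; case: (fetch _ _ _) => //= x.
case: (fetch _ _ _) => //= y; case: (apply_op _ x y) => //= z /IHcs ->.
by rewrite size_rcons addSnnS.
Qed.

Lemma fetch_rcons (inp : I -> F) (res : seq F) (x y : F) o :
  fetch inp res o = Some y -> fetch inp (rcons res x) o = Some y.
Proof.
case: o => //= t; rewrite -cats1 onth_cat; case: ltnP => // /onth_default.
by move=> ->.
Qed.

(** Each executed instruction appends exactly one result, so earlier operands keep their values and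
    the new one sits at position [size cs]. The last hypothesis excludes a failing division. *)
Lemma computes_rcons cs (op : arith_op) u v f g (h : E -> F) :
  computes cs u f -> computes cs v g ->
  (forall e, apply_op op (f e) (g e) = Some (h e)) ->
  extends 1 cs (rcons cs (Instruction op u v)) /\
  computes (rcons cs (Instruction op u v)) (Result (size cs)) h.
Proof.
move=> cu cv ch.
have run e : exists2 res, exec_code (input e) [::] cs = Some res &
    exec_code (input e) [::] (rcons cs (Instruction op u v)) =
      Some (rcons res (h e)).
  move: (cu e) (cv e); rewrite /run_slp /= exec_code_rcons.
  case: exec_code => //= res fu fv; exists res => //.
  by rewrite /exec_instruction /= fu fv ch.
split; first split.
- move=> o k co e; have := co e; have [res] := run e.
  by rewrite /run_slp /= => -> -> /= /fetch_rcons.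
- by rewrite size_rcons addn1.
- move=> e; have [res res1] := run e; rewrite /run_slp /= => -> /=.
  rewrite -cats1 onth_cat (size_exec_code res1) /=.
  by rewrite add0n ltnn subnn.
Qed.

Lemma computes_Input cs (v : I) :
  computes cs Zero (fun=> 0) -> computes cs (Input v) (input ^~ v).
Proof. by move=> c0 e; have := c0 e; rewrite /run_slp; case: exec_code. Qed.

Lemma computes_One cs : computes cs Zero (fun=> 0) -> computes cs One (fun=> 1).
Proof. by move=> c0 e; have := c0 e; rewrite /run_slp; case: exec_code. Qed.

Lemma computes_add cs u v f g : computes cs u f -> computes cs v g ->
  exists cs' o, extends 1 cs cs' /\ computes cs' o (fun e => f e + g e).
Proof.
move=> cu cv; exists (rcons cs (Instruction Add u v)), (Result (size cs)).
exact: computes_rcons cu cv _.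
Qed.

Lemma computes_mul cs u v f g : computes cs u f -> computes cs v g ->
  exists cs' o, extends 1 cs cs' /\ computes cs' o (fun e => f e * g e).
Proof.
move=> cu cv; exists (rcons cs (Instruction Mul u v)), (Result (size cs)).
exact: computes_rcons cu cv _.
Qed.

(** Accumulating onto the available value [h] costs one multiplication and one addition per term. *)
Lemma computes_mul_sum (J : finType) cs (w : operand I) (u v : J -> operand I)
    (h : E -> F) (f g : J -> E -> F) :
  computes cs w h -> (forall j, computes cs (u j) (f j)) ->
  (forall j, computes cs (v j) (g j)) ->
  exists cs' o, extends (2 * #|J|) cs cs' /\
    computes cs' o (fun e => h e + \sum_j f j e * g j e).
Proof.
move=> cw cu cv; rewrite cardE.
suff [cs' [u' [ext co]]] : exists cs' o, extends (2 * size (enum J)) cs cs' /\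
    computes cs' o (fun e => h e + \sum_(j <- enum J) f j e * g j e).
  by exists cs', u'; split=> // e; rewrite co big_enum.
elim/last_ind: (enum J) => [|s j [cs1 [u1 [ext1 co1]]]].
  exists cs, w; rewrite muln0; split; first exact: extends_refl.
  by move=> e; rewrite cw big_nil addr0.
have [cs2 [u2 [ext2 co2]]] := computes_mul (ext1.1 _ _ (cu j)) (ext1.1 _ _ (cv j)).
have [cs3 [u3 [ext3 co3]]] := computes_add (ext2.1 _ _ co1) co2.
exists cs3, u3; split; last by move=> e; rewrite co3 big_rcons /= addrA.
rewrite size_rcons mulnS addnC; apply: (extends_trans ext1).
exact: (extends_trans ext2).
Qed.

(** The hypothesis ranges over all extensions of [cs] because each member is computed after code for
    other members has been appended. *)
Lemma computes_family (J : finType) (c : nat) cs (f : J -> E -> F) :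
  (forall j c' cs', extends c' cs cs' ->
    exists cs2 o, extends c cs' cs2 /\ computes cs2 o (f j)) ->
  exists cs' (o : J -> operand I), extends (c * #|J|) cs cs' /\
    forall j, computes cs' (o j) (f j).
Proof.
move=> step; rewrite cardE.
suff [cs' [u' [ext co]]] : exists cs' (o : J -> operand I),
    extends (c * size (enum J)) cs cs' /\
    {in enum J, forall j, computes cs' (o j) (f j)}.
  by exists cs', u'; split=> // j; apply: co; rewrite mem_enum.
elim: (enum J) => [|j s [cs1 [u1 [ext1 co1]]]].
  by exists cs, (fun=> Zero); rewrite muln0; split=> //; exact: extends_refl.
have [cs2 [u2 [ext2 co2]]] := step j _ _ ext1.
exists cs2, (fun j' => if j' == j then u2 else u1 j'); split.
  by rewrite /= mulnS addnC; exact: (extends_trans ext1).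
move=> j'; rewrite inE; case: eqP => [-> //|_ /=] /co1; exact: ext2.1.
Qed.

Definition computes_mx cs (m n : nat) (X : 'I_m -> 'I_n -> operand I)
    (A : E -> 'M[F]_(m, n)) : Prop :=
  forall i j, computes cs (X i j) (fun e => A e i j).

Lemma computes_mx_extends c cs cs' m n (X : 'I_m -> 'I_n -> operand I)
    (A : E -> 'M[F]_(m, n)) :
  extends c cs cs' -> computes_mx cs X A -> computes_mx cs' X A.
Proof. by move=> ext cA i j; exact: ext.1 _ _ (cA i j). Qed.

(** Each of the [m * n] entries is a [computes_mul_sum] of length [p] started at the entry of [C].
    Fusing the addition lets a sum of products accumulate at no extra cost. *)
Lemma computes_mulmx_add cs (m p n : nat) OC OA OB
    (C : E -> 'M[F]_(m, n)) (A : E -> 'M[F]_(m, p)) (B : E -> 'M[F]_(p, n)) :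
  computes_mx cs OC C -> computes_mx cs OA A -> computes_mx cs OB B ->
  exists cs' X, extends (2 * p * (m * n)) cs cs' /\
    computes_mx cs' X (fun e => C e + A e *m B e).
Proof.
move=> cC cA cB.
have [|cs' [X [ext cO]]] := @computes_family ('I_m * 'I_n)%type (2 * p) cs
    (fun ij e => (C e + A e *m B e) ij.1 ij.2).
  move=> [i j] c' cs' ext /=.
  have [cs2 [u [ext2 co]]] := @computes_mul_sum 'I_p cs' (OC i j) (OA i)
    (OB^~ j) _ _ _ (ext.1 _ _ (cC i j)) (fun l => ext.1 _ _ (cA i l))
    (fun l => ext.1 _ _ (cB l j)).
  exists cs2, u; rewrite card_ord in ext2; split=> // e.
  by rewrite co !mxE.
exists cs', (fun i j => X (i, j)).
by rewrite card_prod !card_ord in ext; split=> // i j; exact: cO (i, j).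
Qed.

End Programs.

(** * Contraction of two tensor trains, one mode at a time *)

Section Contraction.
Context (F : fieldType) (d : nat) (n : 'I_d -> nat) (rA rB : tt_ranks d).
Implicit Types (A : tt_cores F n rA) (B : tt_cores F n rB).
Implicit Types (c i : multi_index n).

(** [rA 0] and [rB 0] equal 1 only propositionally; a constant matrix is well typed for any sizes
    and avoids a cast. *)
Fixpoint tt_contraction A B (m : nat) : (m <= d)%N -> 'M[F]_(rA m, rB m) :=
  match m return (m <= d)%N -> 'M[F]_(rA m, rB m) with
  | 0 => fun=> const_mx 1
  | m'.+1 => fun lt_m'd => let j := Ordinal lt_m'd in
      \sum_(x < n j) ((A j x)^T *m tt_contraction A B (ltnW lt_m'd)) *m B j x
  end.

(* Partial sums run over the full multi-indices whose coordinates from [m] on are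
   frozen to those of [c].  The base index [c] is a parameter because there is
   none when some mode is empty. *)
Definition agree_from c (m : nat) i : bool :=
  [forall j : 'I_d, (m <= j)%N ==> (i j == c j)].

Lemma agree_from0 c i : agree_from c 0 i = (i == c).
Proof.
apply/forallP/eqP => [agr|-> j]; last by rewrite eqxx.
by apply/ffunP => j; exact/eqP/agr.
Qed.

Lemma agree_from_max c i : agree_from c d i.
Proof. by apply/forallP => j; rewrite leqNgt ltn_ord. Qed.

Definition update c (j : 'I_d) (x : 'I_(n j)) : multi_index n :=
  finfun (eqtype.dfwith c x).

(** Fixing coordinate [m] to [x] amounts to freezing one more coordinate, at the price of changing
    the base index. *)
Lemma agree_fromS c i (m : nat) (lt_md : (m < d)%N) (x : 'I_(n (Ordinal lt_md))) :
  agree_from c m.+1 i && (i (Ordinal lt_md) == x) =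
  agree_from (update c x) m i.
Proof.
apply/andP/forallP => [[/forallP agr /eqP ix] j|agr].
  apply/implyP; rewrite ffunE; case: eqtype.dfwithP => [|j' ne_j' le_mj'].
    by rewrite ix.
  have := agr j'; rewrite ltn_neqAle le_mj' andbT.
  by rewrite -(inj_eq val_inj) in ne_j'; rewrite ne_j'.
split; last by have := agr (Ordinal lt_md); rewrite leqnn ffunE eqtype.dfwith_in.
apply/forallP => j; apply/implyP => lt_mj.
have := agr j; rewrite (ltnW lt_mj) ffunE eqtype.dfwith_out //.
by rewrite -(inj_eq val_inj) /= neq_ltn lt_mj.
Qed.

Lemma sum_tt_prefix A B c (m : nat) (le_md : (m <= d)%N) :
  \sum_(i | agree_from c m i)
    ((tt_prefix A i le_md)^T *m const_mx 1) *m tt_prefix B i le_md =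
  tt_contraction A B le_md.
Proof.
elim: m le_md c => [|m IHm] le_md c.
  rewrite (big_pred1 c); last exact: agree_from0.
  by rewrite /= trmx1 mul1mx mulmx1.
(* Splitting by the value [x] of coordinate [m] leaves, for each [x], the induction hypothesis at
   base [update c x], with the slices at [x] factored out on both sides. *)
rewrite (partition_big (fun i => i (Ordinal le_md)) xpredT) //=.
apply: eq_bigr => x _.
rewrite -(IHm (ltnW le_md) (update c x)) mulmx_sumr mulmx_suml.
apply: eq_big => [i|i /andP[_ /eqP ix]]; first exact: agree_fromS.
by rewrite ix trmx_mul !mulmxA.
Qed.

Lemma tt_entryM A B i (a : 'I_(rA d)) (b : 'I_(rB d)) :
  tt_entry A i * tt_entry B i =
  (((tt_prefix A i (leqnn d))^T *m const_mx 1) *m tt_prefix B i (leqnn d)) a b.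
Proof.
rewrite /tt_entry; move: (tt_rank_first rA) (tt_rank_last rA).
move: (tt_rank_first rB) (tt_rank_last rB).
move: (tt_prefix A _ _) (tt_prefix B _ _) => P Q.
(* Once the boundary ranks are variables, [subst] replaces them by 1 and the casts become
   trivial. *)
move: (rA 0) (rA d) (rB 0) (rB d) P Q a b => p a' q b' P Q a b q1 b1 p1 a1.
subst p a' q b'; rewrite !castmx_id !mxE big_ord1 !mxE big_ord1 !mxE mulr1.
by rewrite !ord1.
Qed.

Lemma tensor_inner_contraction A B (T U : tensor F n) i0
    (a : 'I_(rA d)) (b : 'I_(rB d)) :
  tt_format A T -> tt_format B U ->
  tensor_inner T U = tt_contraction A B (leqnn d) a b.
Proof.
move=> AT BU; rewrite -(sum_tt_prefix A B i0 (leqnn d)) summxE.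
rewrite /tensor_inner; apply: eq_big => [i|i _]; first by rewrite agree_from_max.
by rewrite AT BU; exact: tt_entryM.
Qed.

(** With pairs of cores as environments, one program serves all cores of the given mode sizes and
    ranks. *)
Local Notation env := (tt_cores F n rA * tt_cores F n rB)%type.
Local Notation input := (fun AB : env => core_inputs AB.1 AB.2).

Lemma computes_core_step (r N : nat) (j : 'I_d)
    (cs : seq (instruction (core_position n rA + core_position n rB)))
    X (V : env -> 'M[F]_(rA j, rB j)) :
  tt_ranks_bounded rA r -> tt_ranks_bounded rB r -> (n j <= N)%N ->
  computes input cs Zero (fun=> 0) -> computes_mx input cs X V ->
  exists cs' X', extends input (4 * (N * r ^ 3)) cs cs' /\
    computes_mx input cs' X'
      (fun AB => \sum_(x < n j) ((AB.1 j x)^T *m V AB) *m AB.2 j x).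
Proof.
move=> ubA ubB le_nN c0 cV.
suff [cs' [X' [ext cO']]] : exists cs' X',
    extends input (size (enum 'I_(n j)) * (4 * r ^ 3)) cs cs' /\
    computes_mx input cs' X'
      (fun AB => \sum_(x <- enum 'I_(n j)) ((AB.1 j x)^T *m V AB) *m AB.2 j x).
  exists cs', X'; split; last by move=> a b AB; rewrite cO' big_enum.
  by apply: extends_leq ext; rewrite mulnCA size_enum_ord !leq_mul.
have [le_A le_A'] : (rA j <= r)%N /\ (rA j.+1 <= r)%N.
  by split; apply: ubA => //; exact: ltnW.
have [le_B le_B'] : (rB j <= r)%N /\ (rB j.+1 <= r)%N.
  by split; apply: ubB => //; exact: ltnW.
elim/last_ind: (enum _) => [|s x [cs1 [X1 [ext1 cO1]]]].
  exists cs, (fun _ _ => Zero); split; first exact: extends_refl.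
  by move=> a b AB; rewrite c0 big_nil mxE.
have c01 := ext1.1 _ _ c0.
(* Transposing costs no operation: the input positions are merely read with [a] and [b]
   exchanged. *)
have cA : computes_mx input cs1
    (fun b a => Input (inl (Tagged _ (a, x, b)))) (fun AB => (AB.1 j x)^T).
  by move=> b a AB; rewrite (computes_Input _ c01) mxE.
have c0mx : computes_mx input cs1 (fun _ _ => Zero)
    (fun=> 0 : 'M[F]_(rA j.+1, rB j)).
  by move=> a b AB; rewrite c01 mxE.
have [cs2 [X2 [ext2 cO2]]] :=
  computes_mulmx_add c0mx cA (computes_mx_extends ext1 cV).
have cB : computes_mx input cs2
    (fun a b => Input (inr (Tagged _ (a, x, b)))) (fun AB => AB.2 j x).
  by move=> a b; exact: computes_Input _ (ext2.1 _ _ c01).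
(* The second product is accumulated onto the partial sum [X1] of the earlier slices. *)
have [cs3 [X3 [ext3 cO3]]] :=
  computes_mulmx_add (computes_mx_extends ext2 cO1) cO2 cB.
exists cs3, X3; split; last first.
  by move=> a b AB; rewrite cO3 big_rcons add0r.
rewrite size_rcons mulSnr; apply: extends_trans ext1 _.
apply: extends_leq (extends_trans ext2 ext3).
(* One summand per product: the inner dimensions are [rA j] and [rB j], the output sizes [rA j.+1]
   by [rB j] and [rA j.+1] by [rB j.+1]. *)
rewrite (_ : 4 * r ^ 3 = 2 * r * (r * r) + 2 * r * (r * r))%N; last first.
  by rewrite -mulnDl -mulnDl -mulnA.
by rewrite leq_add // !leq_mul.
Qed.

Lemma computes_tt_contraction (r N m : nat) (le_md : (m <= d)%N) :
  tt_ranks_bounded rA r -> tt_ranks_bounded rB r -> (forall j, n j <= N)%N ->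
  exists cs X, [/\ (size cs <= m * (4 * (N * r ^ 3)))%N,
    computes input cs Zero (fun=> 0) &
    computes_mx input cs X (fun AB => tt_contraction AB.1 AB.2 le_md)].
Proof.
move=> ubA ubB le_nN; elim: m le_md => [|m IHm] le_md.
  exists [::], (fun _ _ => One); split=> // a b AB /=; rewrite mxE.
  exact: computes_One.
have [cs [X [size_cs c0 cO]]] := IHm (ltnW le_md).
have [cs' [X' [ext cO']]] :=
  computes_core_step (j := Ordinal le_md) ubA ubB (le_nN _) c0 cO.
exists cs', X'; split=> //; last exact: ext.1.
by rewrite (leq_trans ext.2)// [leqRHS]mulSnr leq_add2r.
Qed.

End Contraction.

Theorem theorem3p5 (R : realType) :
  (forall (d : nat) (n : 'I_d -> nat) (rS rM : tt_ranks d)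
     (S : tensor R n) (GS : tt_cores R n rS)
     (M : mass_tensor R n) (GM : tt_cores R n rM) (k : nat),
     (0 < d)%N -> (0 < k)%N ->
     tt_format GS S -> tt_format GM M ->
     disc_moment S M k =
       (tensor_inner (hadamard_pow S k) M
          / tensor_inner (ones_tensor R n) M)%:E)
  /\
  (exists C : nat,
     forall (d : nat) (n : 'I_d -> nat) (rH rM : tt_ranks d) (r : nat),
     (0 < d)%N ->
     tt_ranks_bounded rH r -> tt_ranks_bounded rM r ->
     exists P : slp (core_position n rH + core_position n rM),
       (operation_count P <= C * (d * (\max_(j < d) n j) * r ^ 3))%N /\
       forall (k : nat) (rS : tt_ranks d)
         (S : tensor R n) (GS : tt_cores R n rS)
         (M : mass_tensor R n) (GM : tt_cores R n rM)
         (GH : tt_cores R n rH),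
         (0 < k)%N ->
         tt_format GS S -> tt_format GM M ->
         tt_format GH (hadamard_pow S k) ->
         run_slp (core_inputs GH GM) P =
           Some (tensor_inner (hadamard_pow S k) M
                   / tensor_inner (ones_tensor R n) M)).
Proof.
split=> [d n rS rM S GS M GM k _ _ _ _|].
  by rewrite disc_moment_sum tensor_inner_ones_mass divr1.
exists 4%N => d n rH rM r _ ubH ubM.
have [cs [X [size_cs _ cO]]] := computes_tt_contraction R (leqnn d) ubH ubM
  (fun j => leq_bigmax (F := n) j).
(* [a] and [b] address the only entry of the final matrix, whose sizes are 1 only up to the rank
   equations. *)
pose a := cast_ord (esym (tt_rank_last rH)) ord0.
pose b := cast_ord (esym (tt_rank_last rM)) ord0.
exists (SLP cs (X a b)); split.
  by rewrite /operation_count /= -mulnA mulnCA.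
move=> k rS S GS M GM GH _ _ GM_M GH_S.
rewrite tensor_inner_ones_mass divr1 (cO a b (GH, GM)) /=.
(* The contraction lemma needs a base index; total mass 1 again rules out an empty index set. *)
have [i0 _|empty] := pickP (multi_index n).
  by rewrite (tensor_inner_contraction i0 a b GH_S GM_M).
have /eqP := mass_sum1 M.
by rewrite big_pred0 1?eq_sym ?oner_eq0 // => i; exact: empty.
Qed.
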